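(* Let $F$ be an exponential field. Then $F$ is existentially closed if and only if for every $n$ and every additively free subvariety $V \subseteq \mathbb{G}_a(F)^n\times\mathbb{G}_m(F)^n$ there is a tuple $\bar a\in F^n$ such that $(\bar a, E(\bar a))\in V$.
   Context: An exponential field is a field $F$ of characteristic $0$ with a homomorphism $E:(F,+)\to(F^\times,\cdot)$; these are the models of the theory $T_{\mathrm{E\text{-}field}}$ in the language $\{+,-,\cdot,0,1,E\}$. $F$ is existentially closed if every finite system of exponential polynomial equations and inequations with coefficients in $F$ that has a solution in some exponential field extending $F$ already has a solution in $F$. A subvariety $V\subseteq \mathbb{G}_a^n\times\mathbb{G}_m^n$ irreducible over $F$ is additively free if, for a point $(\bar x,\bar y)$ of $V$ generic over $F$ (in some field extension of $F$), $\bar x$ satisfies no equation $\sum_{i=1}^n m_ix_i=a$ with $a\in F$ and $m_i\in\mathbb{Z}$ not all zero. $E(\bar a)$ denotes $(E(a_1),\dots,E(a_n))$. *)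

(* Defs.v *)
From HB Require Import structures.
From mathcomp Require Import all_boot all_order all_algebra.
From mathcomp.multinomials Require Import mpoly.

Set Implicit Arguments.
Unset Strict Implicit.
Unset Printing Implicit Defensive.

Import GRing.Theory.
Local Open Scope ring_scope.

Record expFieldType := ExpFieldType {
  expField_sort :> fieldType;
  Exp : expField_sort -> expField_sort;
  expField_pchar0 : [pchar expField_sort] =i pred0;
  Exp_neq0 : forall x, Exp x != 0;
  ExpD : forall x y, Exp (x + y) = Exp x * Exp y
}.

Definition expField_morphism (F K : expFieldType) (iota : {rmorphism F -> K}) :=
  forall x : F, iota (Exp x) = Exp (iota x).

(* Exponential polynomials in n variables over F: terms of the language of
   exponential rings with parameters in F; Exp may be iterated. *)
Inductive expPoly (F : Type) (n : nat) : Type :=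
  | EVar of 'I_n
  | EConst of F
  | EAdd of expPoly F n & expPoly F n
  | EOpp of expPoly F n
  | EMul of expPoly F n & expPoly F n
  | EExp of expPoly F n.

Fixpoint expPoly_eval (F K : expFieldType) (iota : F -> K) (n : nat)
    (v : 'I_n -> K) (t : expPoly F n) : K :=
  match t with
  | EVar i => v i
  | EConst c => iota c
  | EAdd t1 t2 => expPoly_eval iota v t1 + expPoly_eval iota v t2
  | EOpp t1 => - expPoly_eval iota v t1
  | EMul t1 t2 => expPoly_eval iota v t1 * expPoly_eval iota v t2
  | EExp t1 => Exp (expPoly_eval iota v t1)
  end.

Definition expSystem_solution (F K : expFieldType) (iota : F -> K) (n : nat)
    (eqs neqs : seq (expPoly F n)) (v : 'I_n -> K) : Prop :=
  all (fun t => expPoly_eval iota v t == 0) eqs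
  /\ all (fun t => expPoly_eval iota v t != 0) neqs.

Definition existentially_closed (F : expFieldType) : Prop :=
  forall (n : nat) (eqs neqs : seq (expPoly F n)),
    (exists (K : expFieldType) (iota : {rmorphism F -> K}),
       expField_morphism iota
       /\ exists v : 'I_n -> K, expSystem_solution iota eqs neqs v) ->
    exists v : 'I_n -> F, expSystem_solution idfun eqs neqs v.

(* A Zariski closed subset of G_a^n x G_m^n defined over F is given by finitely
   many polynomials over F in the 2n variables (x, y).  As F need not be
   algebraically closed, it is identified with its points in all field
   extensions iota : F -> K, not with its set of F-points alone. *)
Definition closedSubset (F : fieldType) (n : nat) := seq {mpoly F[n + n]}.

Definition join_coord (K : Type) (n : nat) (x y : 'I_n -> K) (i : 'I_(n + n)) :=
  match split i with inl j => x j | inr j => y j end.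

Definition is_point (F K : fieldType) (iota : {rmorphism F -> K}) (n : nat)
    (V : closedSubset F n) (x y : 'I_n -> K) : Prop :=
  (forall i, y i != 0)
  /\ forall p, p \in V -> (map_mpoly iota p).@[join_coord x y] = 0.

Definition closed_eq (F : fieldType) (n : nat) (V W : closedSubset F n) : Prop :=
  forall (K : fieldType) (iota : {rmorphism F -> K}) (x y : 'I_n -> K),
    is_point iota V x y <-> is_point iota W x y.

Definition closed_sub (F : fieldType) (n : nat) (V W : closedSubset F n) : Prop :=
  forall (K : fieldType) (iota : {rmorphism F -> K}) (x y : 'I_n -> K),
    is_point iota V x y -> is_point iota W x y.

Definition closed_nonempty (F : fieldType) (n : nat) (V : closedSubset F n) : Prop :=
  exists (K : fieldType) (iota : {rmorphism F -> K}) (x y : 'I_n -> K),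
    is_point iota V x y.

Definition irreducible_over (F : fieldType) (n : nat) (V : closedSubset F n) : Prop :=
  closed_nonempty V
  /\ forall W1 W2 : closedSubset F n,
       (forall (K : fieldType) (iota : {rmorphism F -> K}) (x y : 'I_n -> K),
          is_point iota V x y <-> is_point iota W1 x y \/ is_point iota W2 x y) ->
       closed_eq V W1 \/ closed_eq V W2.

Definition generic_point (F K : fieldType) (iota : {rmorphism F -> K}) (n : nat)
    (V : closedSubset F n) (x y : 'I_n -> K) : Prop :=
  is_point iota V x y
  /\ forall W : closedSubset F n, is_point iota W x y -> closed_sub V W.

(* The choice of generic point is immaterial: any two satisfy the same
   polynomial equations over F. *)
Definition additively_free (F : fieldType) (n : nat) (V : closedSubset F n) : Prop :=
  irreducible_over V
  /\ exists (K : fieldType) (iota : {rmorphism F -> K}) (x y : 'I_n -> K),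
       generic_point iota V x y
       /\ forall (m : 'I_n -> int) (a : F),
            (exists i, m i != 0) -> \sum_(i < n) x i *~ m i <> iota a.

(* Main.v *)
Require Import Defs.
From HB Require Import structures.
From mathcomp Require Import all_boot all_order all_algebra fieldext.
From mathcomp Require Import boolp ring.
From mathcomp Require classical_sets filter.
From mathcomp.multinomials Require Import mpoly.

Set Implicit Arguments.
Unset Strict Implicit.
Unset Printing Implicit Defensive.

Import Order.TTheory GRing.Theory.
Local Open Scope ring_scope.

(** If [F] is existentially closed and [(x, y)] is a generic point of an
additively free [V], it suffices to embed the field of [(x, y)] in an
exponential field extending [F] with [E(x_i) = y_i]. An ultraproduct of the
fields obtained by adjoining [N!]-th roots of the [y_i] contains homomorphic
rational powers of the [y_i]. As the [x_i] are linearly independent over [Q]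
modulo [F], [E] is well defined on [F + \sum_i Q x_i], and it extends to the
whole field through a [Q]-linear projection onto this subspace.

Conversely, let a system have a solution in an exponential extension of [F].
The solution, the arguments of [E] in the system and the inverses of the values
of the inequations lie in [F + \sum_j Z b_j] for some [b] satisfying no integral
relation modulo [F]. The locus of [(b, E(b))] over [F] is additively free, so it
has a point [(a, E(a))] over [F]. The specialisation [(b, E(b)) -> (a, E(a))]
commutes with [E] on [F + \sum_j Z b_j], hence maps the solution to a
solution in [F]. *)

(** * Hilbert's basis theorem *)

(** Every tail of [g] attains its minimum, as [nat] is well-ordered. Iterating this choice of index
    yields a nondecreasing subsequence. *)
Lemma minimizer_above (g : nat -> nat) (i : nat) :
  exists j, (i < j)%N /\ forall l, (i < l)%N -> (g j <= g l)%N.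
Proof.
have ex : exists k, `[< exists2 j, (i < j)%N & g j = k >].
  by exists (g i.+1); apply/asboolP; exists i.+1.
case: (ex_minnP ex) => k /asboolP [j ij gj] kmin.
exists j; split=> // l il; rewrite gj; apply: kmin.
by apply/asboolP; exists l.
Qed.

Lemma iter_strict_mono (f : nat -> nat) :
  (forall i, (i < f i)%N) -> {homo (fun k => iter k f 0%N) : i j / (i < j)%N}.
Proof.
move=> fP; apply: homo_ltn => [y x z|i] /=; first exact: ltn_trans.
exact: fP.
Qed.

Lemma monotone_subsequence (g : nat -> nat) :
  exists2 phi : nat -> nat, {homo phi : i j / (i < j)%N} &
    {homo g \o phi : i j / (i <= j)%N}.
Proof.
have [nxt nxtP] := choice (minimizer_above g).
(* The iteration starts at [nxt 0], since every chosen index must minimise [g] beyond its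
   predecessor and 0 has none. The next value, taken at a later index, is then at least as large. *)
exists (fun k => iter k.+1 nxt 0%N).
  move=> i j ij; apply: (iter_strict_mono (fun i => (nxtP i).1)).
  by rewrite ltnS.
apply: homo_leq => [//|y x z|i] /=; first exact: leq_trans.
apply: (nxtP _).2.
by apply: (ltn_trans (nxtP _).1 (nxtP _).1).
Qed.

(** Subsequences are extracted for one coordinate after another. Coordinates already treated stay
    monotone along a further subsequence. *)
Lemma dickson_subsequence (n : nat) (f : nat -> 'I_n -> nat) :
  exists2 phi : nat -> nat, {homo phi : i j / (i < j)%N} &
    forall l, {homo (fun i => f (phi i) l) : i j / (i <= j)%N}.
Proof.
suff H (s : seq 'I_n) : exists2 phi : nat -> nat,
    {homo phi : i j / (i < j)%N} &
    forall l, l \in s -> {homo (fun i => f (phi i) l) : i j / (i <= j)%N}.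
  have [phi phi_lt phiP] := H (enum 'I_n).
  by exists phi => // l; apply: phiP; rewrite mem_enum.
elim: s => [|x s [phi phi_lt phiP]]; first by exists id.
have [psi psi_lt psiP] := monotone_subsequence (fun i => f (phi i) x).
exists (phi \o psi) => [i j ij|l]; first exact/phi_lt/psi_lt.
rewrite inE => /predU1P [->|ls] i j ij; first exact: psiP.
apply: (phiP l ls).
by move: ij; rewrite leq_eqVlt => /predU1P [->//|/psi_lt/ltnW].
Qed.

Lemma dickson (n : nat) (f : nat -> 'X_{1.. n}) :
  exists i j, (i < j)%N /\ (f i <= f j)%MM.
Proof.
have [phi phi_lt phiP] := dickson_subsequence (fun i l => f i l).
exists (phi 0%N), (phi 1%N); split; first exact: phi_lt.
by apply/mnm_lepP => l; apply: phiP.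
Qed.

Definition is_ideal (R : comNzRingType) (I : R -> Prop) : Prop :=
  [/\ I 0, forall p q, I p -> I q -> I (p + q) & forall r p, I p -> I (r * p)].

(** Otherwise one could choose successively elements of [A] whose monomials are divisible by none of
    the earlier ones, against Dickson's lemma. *)
Lemma dickson_basis (n : nat) (T : eqType) (mon : T -> 'X_{1.. n})
    (A : T -> Prop) :
  exists2 s : seq T, (forall p, p \in s -> A p) &
    forall p, A p -> exists2 q, q \in s & (mon q <= mon p)%MM.
Proof.
apply: contrapT => noS.
(* The condition on [s] stands below the quantifier on [p], so that choice yields a total function
   [nxt]. *)
have step (s : seq T) : exists p, (forall q, q \in s -> A q) ->
    A p /\ forall q, q \in s -> ~~ (mon q <= mon p)%MM.
  have [sA|nsA] := pselect (forall q, q \in s -> A q); last first.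
    by have /existsNP [p _] := nsA; exists p => /nsA.
  apply: contrapT => nop; apply: noS; exists s => // p Ap.
  apply: contrapT => noq; apply: nop; exists p => _; split=> // q qs.
  by apply/negP => le; apply: noq; exists q.
have [nxt nxtP] := choice step.
pose S k := iter k (fun s => nxt s :: s) [::].
have SA k : forall q, q \in S k -> A q.
  elim: k => [//|k IH] q /=; rewrite inE => /predU1P [->|]; last exact: IH.
  exact: (nxtP _ IH).1.
have Smono i j : (i < j)%N -> nxt (S i) \in S j.
  elim: j => // j IH; rewrite ltnS leq_eqVlt /= inE => /predU1P [->|/IH->].
    by rewrite eqxx.
  by rewrite orbT.
have [i [j [ij le]]] := dickson (fun k => mon (nxt (S k))).
by have /negP := (nxtP _ (SA j)).2 _ (Smono _ _ ij).
Qed.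

(** Generation by [s] is phrased as minimality among ideals, the form applied below to vanishing
    ideals of points. The leading monomials of [s] divide all those of [I], so the division
    algorithm reduces every element of [I] to 0. *)
Lemma hilbert_basis (F : fieldType) (n : nat) (I : {mpoly F[n]} -> Prop) :
  is_ideal I ->
  exists2 s : seq {mpoly F[n]}, (forall p, p \in s -> I p) &
    forall (J : {mpoly F[n]} -> Prop), is_ideal J ->
      (forall p, p \in s -> J p) -> forall p, I p -> J p.
Proof.
case=> I0 ID IM.
have [s sI sP] := dickson_basis (@mlead n F) (fun p => I p /\ p != 0).
exists s => [p /sI []//|J [J0 JD JM] sJ].
elim/(@mleadrect n F) => p IH Ip.
have [->//|p_neq0] := eqVneq p 0.
have [q qs le] := sP p (conj Ip p_neq0).
have [Iq q_neq0] := sI _ qs.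
(* This multiple of [q] has the leading term of [p], so [p - r] is 0 or has a smaller leading
   monomial. *)
pose r : {mpoly F[n]} := (mleadc p / mleadc q) *: ('X_[mlead p - mlead q] * q).
have lq : mleadc q != 0 by rewrite mleadc_eq0.
have lp : mleadc p != 0 by rewrite mleadc_eq0.
have Xnz : 'X_[mlead p - mlead q] != 0 :> {mpoly F[n]}.
  by rewrite -mleadc_eq0 mleadXm mcoeffX eqxx oner_eq0.
have lr : mlead r = mlead p.
  rewrite /r mleadZ ?mulf_neq0 ?invr_eq0 // mleadM //.
  by rewrite mleadXm submK.
have cr : r@_(mlead p) = mleadc p.
  rewrite mcoeffZ -{2}(submK le) mleadcMW ?mleadXm //.
  by rewrite mcoeffX eqxx mul1r divfK.
have rE : r = ((mleadc p / mleadc q) *: 'X_[mlead p - mlead q]) * q.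
  by rewrite -scalerAl.
have Ir : I r by rewrite rE; apply: IM.
have Jr : J r by rewrite rE; apply: JM; apply: sJ.
suff: J (p - r) by move=> /JD /(_ Jr); rewrite subrK.
have I' : I (p - r).
  by apply: ID => //; rewrite -mulN1r; apply: IM.
have [->//|nz] := eqVneq (p - r) 0.
apply: IH => //.
rewrite lt_neqAle; apply/andP; split.
  apply/eqP => e.
  have := mlead_supp nz; rewrite e mcoeff_msupp mcoeffB cr subrr eqxx //.
by apply: (le_trans (mleadB_le _ _)); rewrite lr joinxx.
Qed.

(** * Specialisation of solutions *)

Section Specialization.

Variables (R : comNzRingType) (K F : fieldType).
Variables (f : {rmorphism R -> K}) (g : {rmorphism R -> F}).
Hypothesis ker_fg : forall p, f p = 0 -> g p = 0.

(* The graph of the homomorphism induced by [g] on the localisation of the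
   image of [f] at the kernel of [g]. *)
Definition specializes (z : K) (w : F) : Prop :=
  exists p q, [/\ g q != 0, z * f q = f p & w * g q = g p].

(** Equality of two fractions under [f] says that a cross difference lies in the kernel of [f],
    hence in that of [g]. *)
Lemma specializes_fun z w w' : specializes z w -> specializes z w' -> w = w'.
Proof.
move=> [p [q [gq zf wg]]] [p' [q' [gq' zf' wg']]].
have : f (p * q' - p' * q) = 0.
  by rewrite rmorphB !rmorphM -zf -zf' mulrAC subrr.
move/ker_fg; rewrite rmorphB !rmorphM -wg -wg' mulrAC -!mulrA -mulrBl => /eqP.
by rewrite mulf_eq0 subr_eq0 mulf_eq0 (negPf gq) (negPf gq') !orbF => /eqP.
Qed.

Lemma specializes_img p : specializes (f p) (g p).
Proof. by exists p, 1; rewrite !rmorph1 !mulr1 oner_neq0. Qed.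

Lemma specializes0 : specializes 0 0.
Proof. by have := specializes_img 0; rewrite !rmorph0. Qed.

Lemma specializes1 : specializes 1 1.
Proof. by have := specializes_img 1; rewrite !rmorph1. Qed.

Lemma specializesD z w z' w' :
  specializes z w -> specializes z' w' -> specializes (z + z') (w + w').
Proof.
move=> [p [q [gq zf wg]]] [p' [q' [gq' zf' wg']]].
exists (p * q' + p' * q), (q * q'); rewrite !rmorphD !rmorphM mulf_neq0 //=.
rewrite -zf -zf' -wg -wg' !mulrDl !mulrA.
by split=> //; congr (_ + _); rewrite mulrAC.
Qed.

Lemma specializesM z w z' w' :
  specializes z w -> specializes z' w' -> specializes (z * z') (w * w').
Proof.
move=> [p [q [gq zf wg]]] [p' [q' [gq' zf' wg']]].
exists (p * p'), (q * q'); rewrite !rmorphM mulf_neq0 //=.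
by rewrite -zf -zf' -wg -wg' !mulrA; split=> //; congr (_ * _); rewrite mulrAC.
Qed.

Lemma specializesN z w : specializes z w -> specializes (- z) (- w).
Proof.
by move=> [p [q [gq zf wg]]]; exists (- p), q; rewrite !rmorphN !mulNr zf wg.
Qed.

(** The fraction may be inverted: its numerator is nonzero under [g], hence under [f] by
    [ker_fg]. *)
Lemma specializesV z w : w != 0 -> specializes z w -> specializes z^-1 w^-1.
Proof.
move=> w0 [p [q [gq zf wg]]].
have gp : g p != 0 by rewrite -wg mulf_neq0.
have fp : f p != 0 by apply: contra_neq gp; apply: ker_fg.
exists q, p; rewrite -zf -wg !mulKf //; first by rewrite wg.
by apply: contra_neq fp => z0; rewrite -zf z0 mul0r.
Qed.

Lemma specializesMz z w (m : int) :
  specializes z w -> specializes (z *~ m) (w *~ m).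
Proof.
move=> zw; have N k : specializes (z *+ k) (w *+ k).
  elim: k => [|k IH]; first exact: specializes0.
  by rewrite !mulrS; apply: specializesD.
by case: m => k; [exact: N|apply/specializesN/N].
Qed.

Lemma specializesXz z w (m : int) :
  w != 0 -> specializes z w -> specializes (z ^ m) (w ^ m).
Proof.
move=> w0 zw; have N k : specializes (z ^+ k) (w ^+ k).
  elim: k => [|k IH]; first exact: specializes1.
  by rewrite !exprS; apply: specializesM.
by case: m => k; [exact: N|apply: specializesV (N _); rewrite expf_neq0].
Qed.

Lemma specializes_sum n (z : 'I_n -> K) (w : 'I_n -> F) :
  (forall i, specializes (z i) (w i)) ->
  specializes (\sum_i z i) (\sum_i w i).
Proof.
move=> zw; elim/big_rec2: _ => [|i y1 y2 _]; first exact: specializes0.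
exact: specializesD.
Qed.

Lemma specializes_prod n (z : 'I_n -> K) (w : 'I_n -> F) :
  (forall i, specializes (z i) (w i)) ->
  specializes (\prod_i z i) (\prod_i w i).
Proof.
move=> zw; elim/big_rec2: _ => [|i y1 y2 _]; first exact: specializes1.
exact: specializesM.
Qed.

End Specialization.

(** * Identities in exponential fields *)

Section ExpFieldTheory.

Variable K : expFieldType.
Implicit Types x y : K.

Lemma Exp0 : Exp (0 : K) = 1.
Proof.
apply: (mulfI (Exp_neq0 (0 : K))).
by rewrite -ExpD addr0 mulr1.
Qed.

Lemma ExpN x : Exp (- x) = (Exp x)^-1.
Proof.
by apply: (mulfI (Exp_neq0 x)); rewrite -ExpD subrr Exp0 divff // Exp_neq0.
Qed.

Lemma ExpMz x (m : int) : Exp (x *~ m) = Exp x ^ m.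
Proof.
have N k : Exp (x *+ k) = Exp x ^+ k.
  elim: k => [|k IH]; first by rewrite mulr0n Exp0.
  by rewrite mulrS ExpD IH exprS.
by case: m => k; [exact: N|rewrite ExpN N].
Qed.

Lemma Exp_sum n (x : 'I_n -> K) : Exp (\sum_i x i) = \prod_i Exp (x i).
Proof. by elim/big_rec2: _ => [|i y1 y2 _ <-]; [exact: Exp0|exact: ExpD]. Qed.

End ExpFieldTheory.

Lemma intr_neq0 (K : fieldType) (m : int) :
  [pchar K] =i pred0 -> m != 0 -> m%:~R != 0 :> K.
Proof.
move=> /pcharf0P charK; case: m => k k0; first by rewrite charK.
by rewrite NegzE mulrNz oppr_eq0 charK.
Qed.

(** * Integral bases modulo the base field *)

Section AffineBasis.

Variables (F K : fieldType) (iota : {rmorphism F -> K}).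

Definition in_affine_span k (b : 'I_k -> K) (z : K) : Prop :=
  exists (c : F) (m : 'I_k -> int), z = iota c + \sum_j b j *~ m j.

Definition affinely_free k (b : 'I_k -> K) : Prop :=
  forall (m : 'I_k -> int) (a : F),
    (exists i, m i != 0) -> \sum_i b i *~ m i <> iota a.

(* A relation [\sum_j m_j b_j = a] with [m_i != 0] expresses [b_i] as an
   integral combination, modulo [F], of the elements [b_j / m_i], [j != i]. *)
Lemma affine_basis k (b : 'I_k -> K) : [pchar K] =i pred0 ->
  exists k' (b' : 'I_k' -> K), affinely_free b' /\
    forall z, in_affine_span b z -> in_affine_span b' z.
Proof.
move=> charK; elim: k b => [|k IH] b.
  by exists 0%N, b; split=> // m a [[]].
have [bfree|] := pselect (affinely_free b); first by exists k.+1, b.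
move=> /existsNP [m /existsNP [a /not_implyP [[i mi0] /contrapT rel]]].
have mi : (m i)%:~R != 0 :> K by apply: intr_neq0.
pose b' j := b (lift i j) / (m i)%:~R.
have [k' [b2 [b2free b2P]]] := IH b'; exists k', b2; split=> // z [c [n ->]].
apply: b2P.
(* These coefficients result from eliminating [b i] by the relation and writing each other
   [b (lift i j)] as [m i] times [b' j]. *)
exists (c + a / (m i)%:~R *~ n i),
  (fun j => n (lift i j) * m i - n i * m (lift i j)).
have bi : b i = iota a / (m i)%:~R - \sum_j b' j *~ m (lift i j).
  apply: (mulIf mi); rewrite mulrBl divfK // -rel (bigD1_ord i) //=.
  have -> : (\sum_j b' j *~ m (lift i j)) * (m i)%:~R =
      \sum_j b (lift i j) *~ m (lift i j).
    rewrite mulr_suml; apply: eq_bigr => j _.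
    by rewrite -mulrzl -mulrA divfK // mulrzl.
  by rewrite addrK mulrzr.
rewrite (bigD1_ord i) //= bi rmorphD /= rmorphMz fmorph_div rmorph_int.
have bl j : b (lift i j) = b' j * (m i)%:~R by rewrite divfK.
rewrite mulrzBl -!addrA; congr (_ + (_ + _)).
rewrite -[(\sum_j _) *~ n i]mulrzr mulr_suml -sumrN -big_split /=.
apply: eq_bigr => j _; rewrite bl -[b' j *~ m _]mulrzr.
rewrite -[_ * _ *~ n _]mulrzr -[b' j *~ _]mulrzr rmorphB !rmorphM /=; ring.
Qed.

End AffineBasis.

(** * Vanishing ideals, loci and generic points *)

Section EvalAtPoint.

Variables (F K : fieldType) (iota : {rmorphism F -> K}) (n : nat).

Definition eval_point (x y : 'I_n -> K) : {mpoly F[n + n]} -> K :=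
  meval (join_coord x y) \o map_mpoly iota.

HB.instance Definition _ x y := GRing.RMorphism.copy (eval_point x y)
  (meval (join_coord x y) \o map_mpoly iota).

Lemma eval_pointC x y c : eval_point x y c%:MP = iota c.
Proof. by rewrite /eval_point /= map_mpolyC mevalC. Qed.

Lemma eval_point_x x y j : eval_point x y 'X_(lshift n j) = x j.
Proof.
rewrite /eval_point /= map_mpolyX mevalXU /join_coord.
by rewrite (unsplitK (inl j)).
Qed.

Lemma eval_point_y x y j : eval_point x y 'X_(rshift n j) = y j.
Proof.
rewrite /eval_point /= map_mpolyX mevalXU /join_coord.
by rewrite (unsplitK (inr j)).
Qed.

Lemma eval_point_ideal x y : is_ideal (fun p => eval_point x y p = 0).
Proof.
split=> [|p q p0 q0|r p p0]; first by rewrite rmorph0.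
- by rewrite rmorphD /= p0 q0 addr0.
- by rewrite rmorphM /= p0 mulr0.
Qed.

End EvalAtPoint.

Section Locus.

Variables (F K : fieldType) (iota : {rmorphism F -> K}) (n : nat).

(** [V] consists of generators of the vanishing ideal of [(x, y)]. Whatever vanishes at [(x, y)]
    then vanishes at each point of [V]. *)
Lemma exists_locus (x y : 'I_n -> K) : (forall i, y i != 0) ->
  exists V : closedSubset F n, generic_point iota V x y.
Proof.
move=> y0; have [V VI VP] := hilbert_basis (eval_point_ideal iota x y).
exists V; split=> [//|W [_ Wxy] L j x' y' [y'0 Vx'y']].
split=> // p /Wxy pxy.
exact: (VP _ (eval_point_ideal j x' y') Vx'y' _ pxy).
Qed.

(** The generic point lies in one of the two pieces, and this piece then contains all of [V]. *)
Lemma generic_point_irreducible (V : closedSubset F n) x y :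
  generic_point iota V x y -> irreducible_over V.
Proof.
move=> [Vxy Vgen]; split; first by exists K, iota, x, y.
move=> W1 W2 VW.
have [W1xy|W2xy] := (VW _ _ _ _).1 Vxy; [left|right] => L j x' y'.
  by split; [exact: Vgen|move=> W; apply/VW; left].
by split; [exact: Vgen|move=> W; apply/VW; right].
Qed.

End Locus.

(** * Specialisation of values of exponential polynomials *)

HB.instance Definition _ (F : Type) n := gen_eqMixin (expPoly F n).

Section EvalSpecialization.

Variables (F K : expFieldType) (iota : {rmorphism F -> K}).
Hypothesis iotaE : expField_morphism iota.

(** Specialisation is known to respect [Exp] only on the affine span of [b]. The arguments of [Exp],
    nested ones included, are collected in order to be put into that span. *)
Fixpoint exp_args n (v : 'I_n -> K) (t : expPoly F n) : seq K :=
  match t with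
  | EVar _ | EConst _ => [::]
  | EAdd t1 t2 | EMul t1 t2 => exp_args v t1 ++ exp_args v t2
  | EOpp t1 => exp_args v t1
  | EExp t1 => expPoly_eval iota v t1 :: exp_args v t1
  end.

Variables (k : nat) (b : 'I_k -> K) (a : 'I_k -> F).

Let f := eval_point iota b (fun j => Exp (b j)).
Let g := eval_point (idfun : {rmorphism F -> F}) a (fun j => Exp (a j)).

Hypothesis ker_fg : forall p, f p = 0 -> g p = 0.

Let spec := specializes f g.

Lemma spec_const c : spec (iota c) c.
Proof. by have := specializes_img f g c%:MP; rewrite /= /f /g !eval_pointC. Qed.

(** Integrality of the coefficients makes [Exp z] a constant from [F] times a Laurent monomial in
    the [Exp (b j)]; it specialises because the [Exp (a j)] are nonzero. *)
Lemma in_affine_span_spec z : in_affine_span iota b z ->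
  exists w, spec z w /\ spec (Exp z) (Exp w).
Proof.
move=> [c [m ->]]; exists (c + \sum_j a j *~ m j); split.
  apply: specializesD; first exact: spec_const.
  apply: specializes_sum => j; apply: specializesMz.
  have := specializes_img f g 'X_(lshift k j).
  by rewrite /= /f /g !eval_point_x.
rewrite !ExpD -iotaE !Exp_sum; apply: specializesM; first exact: spec_const.
apply: specializes_prod => j; rewrite !ExpMz; apply: specializesXz => //.
  exact: Exp_neq0.
by have := specializes_img f g 'X_(rshift k j); rewrite /= /f /g !eval_point_y.
Qed.

Lemma eval_spec n (v : 'I_n -> K) (v' : 'I_n -> F) (t : expPoly F n) :
  (forall i, spec (v i) (v' i)) ->
  (forall z, z \in exp_args v t -> in_affine_span iota b z) ->
  spec (expPoly_eval iota v t) (expPoly_eval idfun v' t).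
Proof.
move=> vv'; elim: t => [i|c|t1 IH1 t2 IH2|t1 IH1|t1 IH1 t2 IH2|t1 IH1] /= args.
- exact: vv'.
- exact: spec_const.
- by apply: specializesD; [apply: IH1|apply: IH2] => z zt; apply: args;
    rewrite mem_cat zt ?orbT.
- by apply: specializesN; apply: IH1.
- by apply: specializesM; [apply: IH1|apply: IH2] => z zt; apply: args;
    rewrite mem_cat zt ?orbT.
- have [|w [zw Ezw]] := @in_affine_span_spec (expPoly_eval iota v t1).
    by apply: args; rewrite mem_head.
  have args1 z : z \in exp_args v t1 -> in_affine_span iota b z.
    by move=> zt; apply: args; rewrite inE zt orbT.
  (* The argument of [Exp] specialises to [w] by the span condition and to its own evaluation by
     induction; uniqueness identifies the two. *)
  by rewrite -(specializes_fun ker_fg zw (IH1 args1)).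
Qed.

End EvalSpecialization.

(** * From points on free varieties to solutions of systems *)

Lemma existentially_closed_of_points (F : expFieldType) :
  (forall (n : nat) (V : closedSubset F n), additively_free V ->
     exists a : 'I_n -> F,
       is_point (idfun : {rmorphism F -> F}) V a (fun i => Exp (a i))) ->
  existentially_closed F.
Proof.
move=> pts n eqs neqs [K [iota [iotaE [v [eqsv neqsv]]]]].
pose val t := expPoly_eval iota v t.
(* Adding the inverses of the values of the inequations to the generators
   makes these values specialise to units. *)
pose xs := [seq v i | i <- enum 'I_n]
  ++ flatten [seq exp_args iota v t | t <- eqs ++ neqs]
  ++ [seq (val t)^-1 | t <- neqs].
have xs_span z : z \in xs ->
    in_affine_span iota (fun j => xs`_(j : 'I_(size xs))) z.
  move=> zxs; have zi : (index z xs < size xs)%N by rewrite index_mem.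
  exists 0, (fun j => (j == Ordinal zi) : nat).
  rewrite rmorph0 add0r (bigD1 (Ordinal zi)) //= eqxx nth_index // big1 ?addr0 //.
  by move=> j /negPf ->.
have [k [b [bfree bP]]] := affine_basis iota (fun j => xs`_(j : 'I_(size xs)))
  (@expField_pchar0 K).
have {bP} xs_b z : z \in xs -> in_affine_span iota b z by move=> /xs_span /bP.
have [V Vgen] := exists_locus iota b (fun i => Exp_neq0 (b i)).
have [|a [_ Va]] := pts k V.
  split; first exact: generic_point_irreducible Vgen.
  by exists K, iota, b, (fun i => Exp (b i)).
(* The zero set of [p] contains the generic point of [V], hence also the point [(a, Exp a)]. *)
have ker p : eval_point iota b (fun j => Exp (b j)) p = 0 ->
    eval_point (idfun : {rmorphism F -> F}) a (fun j => Exp (a j)) p = 0.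
  move=> pb; have Wb : is_point iota [:: p] b (fun j => Exp (b j)).
    by split=> [i|q]; [exact: Exp_neq0|rewrite inE => /eqP ->].
  have [|_ Wa] := Vgen.2 _ Wb F idfun a (fun j => Exp (a j)).
    by split=> // i; exact: Exp_neq0.
  by apply: Wa; rewrite mem_head.
have v_spec i : exists w, specializes (eval_point iota b (fun j => Exp (b j)))
    (eval_point (idfun : {rmorphism F -> F}) a (fun j => Exp (a j))) (v i) w.
  have [|w [vw _]] := in_affine_span_spec iotaE ker (z := v i).
    by apply: xs_b; rewrite mem_cat map_f // mem_enum.
  by exists w.
have {v_spec} [v' vv'] := choice v_spec.
have val_spec t : t \in eqs ++ neqs ->
    specializes (eval_point iota b (fun j => Exp (b j)))
      (eval_point (idfun : {rmorphism F -> F}) a (fun j => Exp (a j)))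
      (val t) (expPoly_eval idfun v' t).
  move=> tin; apply: eval_spec => // z zt; apply: xs_b.
  rewrite !mem_cat; apply/orP; right; apply/orP; left.
  by apply/flattenP; exists (exp_args iota v t); rewrite ?map_f.
exists v'; split; apply/allP => t tin.
  apply/eqP; apply: (specializes_fun ker (val_spec t _)).
    by rewrite mem_cat tin.
  by rewrite /val (eqP (allP eqsv _ tin)); exact: specializes0.
have [|w [tw _]] := in_affine_span_spec iotaE ker (z := (val t)^-1).
  apply: xs_b; rewrite !mem_cat; apply/orP; right; apply/orP; right.
  by apply/mapP; exists t.
have tt' : t \in eqs ++ neqs by rewrite mem_cat tin orbT.
(* If the value in [F] were 0, the product of [val t] and its inverse, which is 1, would specialise
   to both 0 and 1. *)
apply/eqP => t0; have := specializesM (val_spec t tt') tw.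
rewrite t0 mul0r divff ?(allP neqsv _ tin) // => s10.
have /eqP := specializes_fun ker s10 (specializes1 _ _).
by rewrite eq_sym oner_eq0.
Qed.

(** * Adjoining roots *)

Lemma irreducible_factor (F : fieldType) (p : {poly F}) : (1 < size p)%N ->
  exists2 q, irreducible_poly q & q %| p.
Proof.
have [k] := ubnP (size p); elim: k p => // k IH p lt_pk p_gt1.
have [irr|] := pselect (irreducible_poly p); first by exists p.
move=> /not_andP [//|/existsNP [q /not_implyP [q1 /not_implyP [qp /negP nqp]]]].
have p0 : p != 0 by rewrite -size_poly_gt0 ltnW.
have lt_qp : (size q < size p)%N.
  by rewrite ltn_neqAle dvdp_size_eqp // nqp dvdp_leq.
have q_gt1 : (1 < size q)%N.
  by rewrite ltn_neqAle eq_sym q1 size_poly_gt0 (dvdpN0 qp).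
have [r rirr rq] := IH q (leq_trans lt_qp lt_pk) q_gt1.
by exists r => //; apply: dvdp_trans rq qp.
Qed.

(** As ['X^M - a%:P] may be reducible, a root of one of its irreducible factors is adjoined. *)
Lemma adjoin_root (F : fieldType) (a : F) (M : nat) : (0 < M)%N ->
  exists (L : fieldType) (j : {rmorphism F -> L}) (z : L), z ^+ M = j a.
Proof.
move=> M0; have [|q qirr qdvd] := @irreducible_factor F ('X^M - a%:P).
  by rewrite size_XnsubC.
have [L _ [z qz _]] := irredp_FAdjoin qirr.
exists L, (GRing.in_alg L), z.
have : map_poly (GRing.in_alg L) q %| map_poly (GRing.in_alg L) ('X^M - a%:P).
  by rewrite dvdp_map.
move=> /root_dvdp /(_ qz).
by rewrite rmorphB /= map_polyXn map_polyC rootE !hornerE subr_eq0 => /eqP.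
Qed.

Lemma adjoin_roots (F : fieldType) (n : nat) (a : 'I_n -> F) (M : nat) :
  (0 < M)%N ->
  exists (L : fieldType) (j : {rmorphism F -> L}) (z : 'I_n -> L),
    forall i, z i ^+ M = j (a i).
Proof.
move=> M0; elim: n a => [|n IH] a; first by exists F, idfun, a; case.
have [L [j [z zP]]] := IH (fun i => a (lift ord0 i)).
have [L' [j' [w wP]]] := adjoin_root (j (a ord0)) M0.
exists L', (j' \o j : {rmorphism F -> L'}).
exists (fun i => if unlift ord0 i is Some i' then j' (z i') else w) => i /=.
by case: unliftP => [i' ->|->] //; rewrite -rmorphXn zP.
Qed.

(** * The embedding of the rationals in characteristic 0 *)

Section RatrPchar0.

Variables (L : fieldType) (charL : [pchar L] =i pred0).

(** The term carries the proof of characteristic 0, so that the morphism structure declared below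
    can be inferred from it. *)
Definition ratr_pchar0 (_ : [pchar L] =i pred0) : rat -> L := ratr.

Local Notation h := (ratr_pchar0 charL).

(** [ratr] uses the reduced fraction; any other fraction with the same value agrees by cross
    multiplication. *)
Lemma ratr_pchar0_frac (a b : int) : b != 0 ->
  h (a%:~R / b%:~R) = a%:~R / b%:~R.
Proof.
move=> b0; rewrite /ratr_pchar0 /ratr; set q : rat := _ / _.
have bq : b%:~R != 0 :> rat by rewrite intr_eq0.
apply/eqP; rewrite eqr_div ?intr_neq0 ?denq_neq0 // -!rmorphM /=; apply/eqP.
congr (_%:~R); apply/(@intr_inj rat); rewrite !rmorphM /=.
apply/eqP; rewrite -eqr_div ?intr_eq0 ?denq_neq0 //.
by rewrite divq_num_den.
Qed.

Lemma ratr_pchar0_zmod : zmod_morphism h.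
Proof.
move=> x y; rewrite -{1}(divq_num_den x) -{1}(divq_num_den y).
have nz (q : rat) : (denq q)%:~R != 0 :> L by rewrite intr_neq0 ?denq_neq0.
have nzq (q : rat) : (denq q)%:~R != 0 :> rat by rewrite intr_eq0 denq_neq0.
rewrite -mulNr addf_div // -rmorphN -!rmorphM -rmorphD /=.
rewrite ratr_pchar0_frac ?mulf_neq0 ?denq_neq0 //.
rewrite rmorphD !rmorphM rmorphN /= /ratr_pchar0 /ratr.
by rewrite -[in RHS]mulNr addf_div.
Qed.

Lemma ratr_pchar0_monoid : monoid_morphism h.
Proof.
split=> [|x y]; first by rewrite /ratr_pchar0 /ratr divr1.
rewrite -{1}(divq_num_den x) -{1}(divq_num_den y) mulf_div -!rmorphM /=.
rewrite ratr_pchar0_frac ?mulf_neq0 ?denq_neq0 //.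
by rewrite !rmorphM /= /ratr_pchar0 /ratr mulf_div.
Qed.

HB.instance Definition _ :=
  GRing.isZmodMorphism.Build rat L h ratr_pchar0_zmod.
HB.instance Definition _ :=
  GRing.isMonoidMorphism.Build rat L h ratr_pchar0_monoid.

End RatrPchar0.

(** * Complements of subspaces *)

Section Complement.

Variables (k L : fieldType) (h : {rmorphism k -> L}).

Definition is_subspace (C : L -> Prop) : Prop :=
  [/\ C 0, forall x y, C x -> C y -> C (x + y)
    & forall t x, C x -> C (h t * x)].

Lemma subspaceB C x y : is_subspace C -> C x -> C y -> C (x - y).
Proof.
move=> [_ CD CM] Cx Cy; apply: CD => //.
by have := CM (-1) _ Cy; rewrite rmorphN1 mulN1r.
Qed.

Variables (G : L -> Prop) (Gsub : is_subspace G).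

(** Zorn's lemma gives a subspace maximal among those meeting [G] in 0. If it missed some [z] modulo
    [G], adding the line through [z] would contradict maximality. *)
Lemma exists_complement : exists C : L -> Prop,
  [/\ is_subspace C, forall z, C z -> G z -> z = 0 &
      forall z, exists x y, [/\ G x, C y & z = x + y]].
Proof.
(* Adjoining 0 makes the union of the empty chain admissible. *)
pose D (A : L -> Prop) x := x = 0 \/ A x.
pose P A := is_subspace (D A) /\ forall z, D A z -> G z -> z = 0.
have [|A [[Asub AG] Amax]] := @classical_sets.Zorn_bigcup L P.
  move=> X XP Xtot; split; last first.
    move=> z [//|[B XB Bz]]; apply: (XP _ XB).2; by right.
  split; first by left.
    move=> x y [->|[B XB Bx]]; first by rewrite add0r.
    move=> [->|[B' XB' By]]; first by rewrite addr0; right; exists B.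
    have [BB'|B'B] := Xtot _ _ XB XB'.
      have [[_ BD _] _] := XP _ XB'.
      by have [->|?] := BD _ _ (or_intror (BB' _ Bx)) (or_intror By);
        [left|right; exists B'].
    have [[_ BD _] _] := XP _ XB.
    by have [->|?] := BD _ _ (or_intror Bx) (or_intror (B'B _ By));
      [left|right; exists B].
  move=> t x [->|[B XB Bx]]; first by rewrite mulr0; left.
  have [[_ _ BM] _] := XP _ XB.
  by have [->|?] := BM t _ (or_intror Bx); [left|right; exists B].
exists (D A); split=> // z; apply: contrapT => nz.
have [A0 AD AM] := Asub; have [G0 GD GM] := Gsub.
pose B x := exists t y, D A y /\ x = y + h t * z.
have Bsub : is_subspace B.
  split; first by exists 0, 0; rewrite rmorph0 mul0r addr0.
    move=> x y [t [u [Au ->]]] [t' [u' [Au' ->]]].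
    exists (t + t'), (u + u'); split; first exact: AD.
    by rewrite rmorphD mulrDl addrACA.
  move=> s x [t [u [Au ->]]]; exists (s * t), (h s * u); split; first exact: AM.
  by rewrite mulrDr rmorphM mulrA.
have BG x : B x -> G x -> x = 0.
  move=> [t [u [Au xE]]] Gx; have [t0|t0] := eqVneq t 0.
    by apply: AG => //; rewrite xE t0 rmorph0 mul0r addr0.
  (* With [t] nonzero, solving [x = u + h t * z] for [z] gives the decomposition assumed not to
     exist. *)
  case: nz; exists (h t^-1 * x), (- (h t^-1 * u)); split; first exact: GM.
    by rewrite -mulN1r -(rmorphN1 h); apply/AM/AM.
  by rewrite xE mulrDr addrAC subrr add0r mulrA -rmorphM mulVf // rmorph1 mul1r.
have DB : D B = B.
  apply/funext => x; apply/propext; split; last by right.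
  by move=> [->|//]; case: Bsub.
have Bz : B z by exists 1, 0; rewrite rmorph1 mul1r add0r.
apply: (Amax B); last by rewrite /P DB.
split=> [x Ax|BA].
  by exists 0, x; rewrite rmorph0 mul0r addr0; split=> //; right.
by case: nz; exists 0, z; rewrite add0r; split=> //; right; apply: BA.
Qed.

(** The component in [G] is unique, since two candidates differ by an element of both [G] and the
    complement; additivity follows. *)
Lemma exists_projection : exists pr : L -> L,
  [/\ forall z, G (pr z), forall z, G z -> pr z = z &
      forall x y, pr (x + y) = pr x + pr y].
Proof.
have [C [Csub CG GC]] := exists_complement.
have {GC} GC z : exists x, G x /\ C (z - x).
  by have [x [y [Gx Cy ->]]] := GC z; exists x; rewrite addrAC subrr add0r.
have [pr prP] := choice GC; have [C0 CD _] := Csub; have [G0 GD _] := Gsub.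
have uniq z x : G x -> C (z - x) -> pr z = x.
  move=> Gx Czx; apply/eqP; rewrite -subr_eq0; apply/eqP/CG.
    have -> : pr z - x = (z - x) - (z - pr z) by ring.
    by apply: subspaceB => //; exact: (prP z).2.
  by apply: subspaceB => //; exact: (prP z).1.
exists pr; split=> [z|z Gz|x y]; first exact: (prP z).1.
  by apply: uniq => //; rewrite subrr.
apply: uniq; first by apply: GD; exact: (prP _).1.
by rewrite opprD addrACA; apply: CD; exact: (prP _).2.
Qed.

End Complement.

(** * Ultraproducts of fields *)

Section Ultraproduct.

Variables (K : nat -> fieldType) (U : classical_sets.set_system nat).
Variable UU : filter.UltraFilter U.

Let UF : filter.Filter U := filter.filter_filter.

Lemma ultra_mono (A B : nat -> Prop) : (forall N, A N -> B N) -> U A -> U B.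
Proof. exact: filter.filterS. Qed.

Lemma ultra_all (A : nat -> Prop) : (forall N, A N) -> U A.
Proof. by move=> AT; apply: ultra_mono filter.filterT. Qed.

Lemma ultra_mono2 (A B C : nat -> Prop) :
  (forall N, A N -> B N -> C N) -> U A -> U B -> U C.
Proof.
by move=> ABC UA UB; apply: ultra_mono (filter.filterI UA UB) => N [/ABC]; apply.
Qed.

Definition ultra_eq (f g : forall N, K N) : bool :=
  `[< U (fun N => f N = g N) >].

Lemma ultra_eq_refl : reflexive ultra_eq.
Proof. by move=> f; apply/asboolP/ultra_all. Qed.

Lemma ultra_eq_sym : ssrbool.symmetric ultra_eq.
Proof.
by move=> f g; apply/asboolP/asboolP; apply: ultra_mono => N ->.
Qed.

Lemma ultra_eq_trans : transitive ultra_eq.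
Proof.
move=> g f l /asboolP fg /asboolP gl; apply/asboolP.
by apply: ultra_mono2 fg gl => N -> ->.
Qed.

Canonical ultra_eq_equiv :=
  EquivRel ultra_eq ultra_eq_refl ultra_eq_sym ultra_eq_trans.

Definition ultraproduct := {eq_quot ultra_eq}%qT.

HB.instance Definition _ := Choice.on ultraproduct.

Definition upi (f : forall N, K N) : ultraproduct :=
  (\pi_{eq_quot ultra_eq} f)%qT.

Lemma upiP f g : U (fun N => f N = g N) <-> upi f = upi g.
Proof. by split=> [fg|/eqmodP/asboolP//]; apply/eqmodP/asboolP. Qed.

Lemma upi_surj (x : ultraproduct) : exists f, x = upi f.
Proof. by exists (repr x); rewrite /upi reprK. Qed.

(** The operations act on chosen representatives; [uaddE], [umulE], [uoppE] and [uinvE] give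
    independence of the choice. *)
Definition uadd (x y : ultraproduct) := upi (fun N => repr x N + repr y N).
Definition uopp (x : ultraproduct) := upi (fun N => - repr x N).
Definition umul (x y : ultraproduct) := upi (fun N => repr x N * repr y N).
Definition uinv (x : ultraproduct) := upi (fun N => (repr x N)^-1).

Lemma repr_upi f : U (fun N => repr (upi f) N = f N).
Proof. by apply/upiP; rewrite /upi reprK. Qed.

Lemma uaddE f g : uadd (upi f) (upi g) = upi (fun N => f N + g N).
Proof.
by apply/upiP; apply: ultra_mono2 (repr_upi f) (repr_upi g) => N -> ->.
Qed.

Lemma umulE f g : umul (upi f) (upi g) = upi (fun N => f N * g N).
Proof.
by apply/upiP; apply: ultra_mono2 (repr_upi f) (repr_upi g) => N -> ->.
Qed.

Lemma uoppE f : uopp (upi f) = upi (fun N => - f N).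
Proof. by apply/upiP; apply: ultra_mono (repr_upi f) => N ->. Qed.

Lemma uinvE f : uinv (upi f) = upi (fun N => (f N)^-1).
Proof. by apply/upiP; apply: ultra_mono (repr_upi f) => N ->. Qed.

Let u0 := upi (fun N => 0).
Let u1 := upi (fun N => 1).

Local Ltac uring tac :=
  rewrite /u0 /u1 ?(uaddE, umulE, uoppE); apply/upiP; apply: ultra_all => N; tac.

Lemma uaddA : associative uadd.
Proof.
move=> x y z; have [f ->] := upi_surj x; have [g ->] := upi_surj y.
have [l ->] := upi_surj z; by uring ltac:(rewrite addrA).
Qed.

Lemma uaddC : commutative uadd.
Proof.
move=> x y; have [f ->] := upi_surj x; have [g ->] := upi_surj y.
by uring ltac:(rewrite addrC).
Qed.

Lemma uadd0 : left_id u0 uadd.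
Proof. by move=> x; have [f ->] := upi_surj x; uring ltac:(rewrite add0r). Qed.

Lemma uaddN : left_inverse u0 uopp uadd.
Proof. by move=> x; have [f ->] := upi_surj x; uring ltac:(rewrite addNr). Qed.

HB.instance Definition _ :=
  GRing.isZmodule.Build ultraproduct uaddA uaddC uadd0 uaddN.

Lemma umulA : associative umul.
Proof.
move=> x y z; have [f ->] := upi_surj x; have [g ->] := upi_surj y.
have [l ->] := upi_surj z; by uring ltac:(rewrite mulrA).
Qed.

Lemma umulC : commutative umul.
Proof.
move=> x y; have [f ->] := upi_surj x; have [g ->] := upi_surj y.
by uring ltac:(rewrite mulrC).
Qed.

Lemma umul1 : left_id u1 umul.
Proof. by move=> x; have [f ->] := upi_surj x; uring ltac:(rewrite mul1r). Qed.

Lemma umulD : left_distributive umul uadd.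
Proof.
move=> x y z; have [f ->] := upi_surj x; have [g ->] := upi_surj y.
have [l ->] := upi_surj z; by uring ltac:(rewrite mulrDl).
Qed.

Lemma u1_neq0 : u1 != 0.
Proof.
apply/eqP => /upiP U10; apply: (filter.filter_not_empty U).
by apply: ultra_mono U10 => N /eqP; rewrite oner_eq0.
Qed.

HB.instance Definition _ :=
  GRing.Zmodule_isComNzRing.Build ultraproduct umulA umulC umul1 umulD u1_neq0.

(** Maximality of the ultrafilter enters here: a sequence not zero on a large set is nonzero on a
    large set, where it can be inverted. *)
Lemma umulV (x : ultraproduct) : x != 0 -> uinv x * x = 1.
Proof.
have [f ->] := upi_surj x; move=> /eqP f0.
have [Uf0|Ufn0] := filter.in_ultra_setVsetC (fun N => f N = 0) UU.
  by case: f0; apply/upiP.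
rewrite uinvE; rewrite [LHS]umulE; apply/upiP.
by apply: ultra_mono Ufn0 => N /eqP fN; rewrite mulVf.
Qed.

Lemma uinv0 : uinv 0 = 0.
Proof.
by rewrite [LHS]uinvE; apply/upiP; apply: ultra_all => N; rewrite invr0.
Qed.

HB.instance Definition _ :=
  GRing.ComNzRing_isField.Build ultraproduct umulV uinv0.

Lemma upiM f g : upi (fun N => f N * g N) = upi f * upi g.
Proof. by rewrite -umulE. Qed.

Section Diagonal.

Variables (K0 : fieldType) (j : forall N, {rmorphism K0 -> K N}).

Definition udiag (x : K0) : ultraproduct := upi (fun N => j N x).

Lemma udiag_zmod : zmod_morphism udiag.
Proof.
move=> x y; rewrite -[RHS]/(uadd (udiag x) (uopp (udiag y))) uoppE uaddE.
by apply/upiP; apply: ultra_all => N; rewrite rmorphB.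
Qed.

Lemma udiag_monoid : monoid_morphism udiag.
Proof.
split=> [|x y]; first by apply/upiP; apply: ultra_all => N; rewrite rmorph1.
by rewrite -upiM; apply/upiP; apply: ultra_all => N; rewrite rmorphM.
Qed.

HB.instance Definition _ :=
  GRing.isZmodMorphism.Build K0 ultraproduct udiag udiag_zmod.
HB.instance Definition _ :=
  GRing.isMonoidMorphism.Build K0 ultraproduct udiag udiag_monoid.

End Diagonal.

End Ultraproduct.

(** * Rational powers in an ultraproduct *)

Lemma eventually_ultrafilter :
  exists U, filter.UltraFilter U /\
    forall (A : nat -> Prop) m, (forall N, (m <= N)%N -> A N) -> U A.
Proof.
(* The sets containing a tail form a proper filter, which extends to an ultrafilter. *)
pose E (A : nat -> Prop) := exists m, forall N, (m <= N)%N -> A N.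
have EP : filter.ProperFilter E.
  split; first by move=> [m /(_ m (leqnn m))].
  split; first by exists 0%N.
    move=> A B [m Am] [m' Bm']; exists (maxn m m') => N.
    by rewrite geq_max => /andP [/Am ? /Bm' ?].
  by move=> A B AB [m Am]; exists m => N /Am /AB.
have [U [UU EU]] := filter.ultraFilterLemma EP.
by exists U; split=> // A m Am; apply: EU; exists m.
Qed.

Lemma int_mul_fact (q : rat) N : (`|denq q| <= N)%N ->
  q * (N`!)%:~R = (numq (q * (N`!)%:~R))%:~R.
Proof.
move=> dN; rewrite numqK // -{1}(divq_num_den q) mulrAC -rmorphM /=.
apply: Qint_dvdz; rewrite dvdz_mull //= dvdzE /= dvdn_fact //.
by rewrite dN absz_gt0 denq_neq0.
Qed.

(* With [z_N ^ N! = y], the power [y ^ q] is the class of the sequence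
   [z_N ^ (q N!)], whose exponents are eventually integers. *)
Lemma rational_powers (K : fieldType) n (y : 'I_n -> K) :
  (forall i, y i != 0) ->
  exists (L : fieldType) (j : {rmorphism K -> L}) (rho : 'I_n -> rat -> L),
    (forall i q r, rho i (q + r) = rho i q * rho i r) /\
    (forall i, rho i 1 = j (y i)).
Proof.
move=> y0; have [U [UU Uev]] := eventually_ultrafilter.
have ext N : exists Lj : {L : fieldType & {rmorphism K -> L}},
    exists z : 'I_n -> projT1 Lj, forall i, z i ^+ N`! = projT2 Lj (y i).
  have [L [j [z zP]]] := adjoin_roots y (fact_gt0 N).
  by exists (existT _ L j), z.
pose Lj N := projT1 (cid (ext N)).
have [z zP] : exists z : forall N, 'I_n -> projT1 (Lj N),
    forall N i, z N i ^+ N`! = projT2 (Lj N) (y i).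
  pose zz N := cid (projT2 (cid (ext N))).
  by exists (fun N => projT1 (zz N)) => N; exact: (projT2 (zz N)).
pose KN N := projT1 (Lj N); pose j N : {rmorphism K -> KN N} := projT2 (Lj N).
have z0 N i : z N i != 0.
  by have := y0 i; rewrite -(fmorph_eq0 (projT2 (Lj N))) -zP expf_eq0 fact_gt0.
exists (ultraproduct KN UU), (udiag UU j).
(* When [q * N!] is not an integer, [numq] supplies an arbitrary exponent; this affects only
   finitely many [N], hence not the class. *)
exists (fun i q => upi UU (fun N => z N i ^ numq (q * (N`!)%:~R) : KN N)).
split=> [i q r|i].
  rewrite -upiM; apply/upiP.
  (* From this bound on, all three denominators divide [N!], so the exponents are the true ones and
     add up. *)
  apply: (Uev _ (maxn `|denq (q + r)| (maxn `|denq q| `|denq r|))) => N.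
  rewrite !geq_max => /and3P [dqr dq dr].
  have -> : numq ((q + r) * (N`!)%:~R) =
      numq (q * (N`!)%:~R) + numq (r * (N`!)%:~R).
    by apply/(@intr_inj rat); rewrite rmorphD /= -!int_mul_fact // mulrDl.
  by rewrite expfzDr.
apply/upiP; apply: (Uev _ 0%N) => N _.
by rewrite mul1r numq_int -zP.
Qed.

(** * Extending the exponential map *)

Section ExpExtension.

Variables (F : expFieldType) (K : fieldType) (iota : {rmorphism F -> K}).
Variables (n : nat) (x y : 'I_n -> K).
Hypotheses (y_neq0 : forall i, y i != 0) (x_free : affinely_free iota x).

Section RationalCombinations.

Variables (L : fieldType) (j : {rmorphism K -> L}) (charL : [pchar L] =i pred0).

Local Notation h := (ratr_pchar0 charL).

Definition rat_comb (f : F) (q : 'I_n -> rat) : L :=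
  j (iota f) + \sum_i h (q i) * j (x i).

Lemma rat_combD f q f' q' :
  rat_comb (f + f') (fun i => q i + q' i) = rat_comb f q + rat_comb f' q'.
Proof.
rewrite /rat_comb !rmorphD /= addrACA -big_split /=; congr (_ + _).
by apply: eq_bigr => i _; rewrite rmorphD mulrDl.
Qed.

Lemma rat_combZ t f q :
  rat_comb (ratr t * f) (fun i => t * q i) = h t * rat_comb f q.
Proof.
rewrite /rat_comb (rmorphM iota) (rmorphM j) !fmorph_rat mulrDr mulr_sumr.
congr (_ + _).
by apply: eq_bigr => i _; rewrite rmorphM mulrA.
Qed.

(** If some [q i] were nonzero, clearing denominators would give an integral relation between the
    [x i] modulo [F], against [x_free]. *)
Lemma rat_comb_eq0 f q : rat_comb f q = 0 -> f = 0 /\ forall i, q i = 0.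
Proof.
move=> fq0.
suff q0 i : q i = 0.
  split=> //; move: fq0; rewrite /rat_comb big1 => [|i _].
    by rewrite addr0 => /eqP; rewrite !fmorph_eq0 => /eqP.
  by rewrite q0 rmorph0 mul0r.
apply/eqP; apply: contrapT => /negP qi.
pose D := \prod_i denq (q i).
pose m i := numq (q i) * \prod_(i' < n | i' != i) denq (q i').
have D0 : D != 0 by apply/prodf_neq0 => i' _; rewrite denq_neq0.
have mE i' : h D%:~R * h (q i') = (m i')%:~R.
  rewrite -rmorphM -[RHS](rmorph_int h) /=; congr (ratr_pchar0 charL _).
  by rewrite /D (bigD1 i') //= !rmorphM /= numqE mulrC mulrA.
apply: (@x_free m (- ((ratr D%:~R : F) * f))).
  exists i; rewrite mulf_neq0 ?numq_eq0 //.
  by apply/prodf_neq0 => i' _; rewrite denq_neq0.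
apply: (fmorph_inj j); apply/eqP; rewrite !rmorphN -addr_eq0; apply/eqP.
rewrite -[RHS](mulr0 (h D%:~R)) -fq0 -rat_combZ /rat_comb addrC.
congr (_ + _); rewrite rmorph_sum; apply: eq_bigr => i' _.
by rewrite rmorphMz rmorphM /= mE mulrzl.
Qed.

Lemma rat_comb_inj f q f' q' : rat_comb f q = rat_comb f' q' ->
  f = f' /\ forall i, q i = q' i.
Proof.
move=> /eqP; rewrite -subr_eq0 -mulN1r -(rmorphN1 h) -rat_combZ -rat_combD.
move=> /eqP /rat_comb_eq0 [].
rewrite [ratr _](rmorphN1 (ratr_pchar0 (@expField_pchar0 F))) mulN1r.
move=> /eqP; rewrite subr_eq0 => /eqP -> q0; split=> // i.
by apply/eqP; rewrite -subr_eq0 -(q0 i) mulN1r.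
Qed.

Lemma rat_comb_subspace : is_subspace h (fun z => exists f q, z = rat_comb f q).
Proof.
split=> [|z z' [f [q ->]] [f' [q' ->]]|t z [f [q ->]]].
- exists 0, (fun=> 0); rewrite /rat_comb !rmorph0 add0r big1 // => i _.
  by rewrite mul0r.
- by exists (f + f'), (fun i => q i + q' i); rewrite rat_combD.
- by exists (ratr t * f), (fun i => t * q i); rewrite rat_combZ.
Qed.

End RationalCombinations.

Lemma exp_extension : exists (L : expFieldType) (j : {rmorphism K -> L}),
  expField_morphism (j \o iota : {rmorphism F -> L}) /\
  forall i, Exp (j (x i)) = j (y i).
Proof.
have [L [j [rho [rhoD rho1]]]] := rational_powers y_neq0.
have charL : [pchar L] =i pred0.
  by move=> p; rewrite (fmorph_pchar j) (fmorph_pchar iota) expField_pchar0.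
have rho0 i : rho i 0 = 1.
  have /mulfI : rho i 1 != 0 by rewrite rho1 fmorph_eq0.
  by apply; rewrite -rhoD addr0 mulr1.
have rho_neq0 i q : rho i q != 0.
  apply/eqP => q0; have := rho0 i; rewrite -(subrr q) rhoD q0 mul0r => /eqP.
  by rewrite eq_sym oner_eq0.
have [pr [prG prid prD]] := exists_projection (rat_comb_subspace j charL).
(* The value is required to fit all representations of [pr z], so the function obtained by choice
   can be computed from any of them. *)
have E_ex z : exists w, forall f q, pr z = rat_comb j charL f q ->
    w = j (iota (Exp f)) * \prod_i rho i (q i).
  have [f [q zE]] := prG z.
  exists (j (iota (Exp f)) * \prod_i rho i (q i)) => f' q'.
  rewrite zE => /rat_comb_inj [-> qq']; congr (_ * _).
  by apply: eq_bigr => i _; rewrite qq'.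
have [E EP] := choice E_ex.
have E_neq0 z : E z != 0.
  have [f [q /EP ->]] := prG z; rewrite mulf_neq0 ?fmorph_eq0 ?Exp_neq0 //.
  exact/prodf_neq0.
have ED z z' : E (z + z') = E z * E z'.
  have [f [q zE]] := prG z; have [f' [q' z'E]] := prG z'.
  rewrite (EP _ _ _ zE) (EP _ _ _ z'E).
  rewrite (EP _ (f + f') (fun i => q i + q' i)); last first.
    by rewrite prD zE z'E rat_combD.
  rewrite ExpD !rmorphM /= mulrACA -big_split /=; congr (_ * _).
  by apply: eq_bigr => i _; rewrite rhoD.
have E_eq f q : E (rat_comb j charL f q) =
    j (iota (Exp f)) * \prod_i rho i (q i).
  by apply: EP; apply: prid; exists f, q.
exists (ExpFieldType charL E_neq0 ED), j; split=> [f|i] /=.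
  have /= -> : j (iota f) = rat_comb j charL f (fun=> 0).
    by rewrite /rat_comb big1 ?addr0 // => i _; rewrite rmorph0 mul0r.
  by rewrite E_eq big1 ?mulr1 // => i _; rewrite rho0.
have -> : j (x i) = rat_comb j charL 0 (fun i' => (i' == i)%:R).
  rewrite /rat_comb !rmorph0 add0r (bigD1 i) //= eqxx rmorph1 mul1r.
  by rewrite big1 ?addr0 // => i' /negPf ->; rewrite rmorph0 mul0r.
rewrite E_eq Exp0 !rmorph1 mul1r (bigD1 i) //= eqxx rho1 big1 ?mulr1 //.
by move=> i' /negPf ->; rewrite rho0.
Qed.

End ExpExtension.

(** * Polynomials as exponential polynomials, and the equivalence *)

Lemma mpoly_ring_ind (R : comNzRingType) n (P : {mpoly R[n]} -> Prop) :
  (forall c, P c%:MP) -> (forall i, P 'X_i) ->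
  (forall p q, P p -> P q -> P (p + q)) ->
  (forall p q, P p -> P q -> P (p * q)) -> forall p, P p.
Proof.
move=> PC PX PD PM p; rewrite [p]mpolyE.
elim/big_ind: _ => [||m _]; [by rewrite -mpolyC0|exact: PD|].
rewrite -mul_mpolyC; apply: (PM) => //; rewrite mpolyXE_id.
elim/big_ind: _ => [||i _]; [by rewrite -mpolyC1|exact: PM|].
by elim: (m i) => [|d IH]; rewrite ?expr0 -?mpolyC1 // exprS; apply: PM.
Qed.

Lemma eval_point_rmorph (F K L : fieldType) (iota : {rmorphism F -> K})
    (j : {rmorphism K -> L}) n (x y : 'I_n -> K) (x' y' : 'I_n -> L) p :
  (forall i, x' i = j (x i)) -> (forall i, y' i = j (y i)) ->
  eval_point (j \o iota : {rmorphism F -> L}) x' y' p =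
    j (eval_point iota x y p).
Proof.
move=> x'E y'E; elim/mpoly_ring_ind: p => [c|i|p q IHp IHq|p q IHp IHq].
- by rewrite !eval_pointC.
- rewrite -(splitK i); case: (split i) => i' /=.
    by rewrite !eval_point_x.
  by rewrite !eval_point_y.
- by rewrite !rmorphD /= IHp IHq.
- by rewrite !rmorphM /= IHp IHq.
Qed.

(** One term serves for all exponential fields, so a system solved in an extension can be read back
    in [F]. *)
Lemma mpoly_expPoly (F : expFieldType) n (p : {mpoly F[n + n]}) :
  exists t : expPoly F n,
    forall (K : expFieldType) (iota : {rmorphism F -> K}) (v : 'I_n -> K),
      expPoly_eval iota v t = eval_point iota v (fun i => Exp (v i)) p.
Proof.
elim/mpoly_ring_ind: p => [c|i|p q [s sP] [t tP]|p q [s sP] [t tP]].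
- by exists (EConst n c) => K iota v; rewrite eval_pointC.
- rewrite -(splitK i); case: (split i) => i' /=.
    by exists (EVar F i') => K iota v; rewrite eval_point_x.
  by exists (EExp (EVar F i')) => K iota v; rewrite eval_point_y.
- by exists (EAdd s t) => K iota v; rewrite rmorphD /= sP tP.
- by exists (EMul s t) => K iota v; rewrite rmorphM /= sP tP.
Qed.

Theorem theorem3p5 (F : expFieldType) :
  existentially_closed F <->
  (forall (n : nat) (V : closedSubset F n), additively_free V ->
     exists a : 'I_n -> F,
       is_point (idfun : {rmorphism F -> F}) V a (fun i => Exp (a i))).
Proof.
split; last exact: existentially_closed_of_points.
move=> ecF n V [_ [K [iota [x [y [[[y_neq0 Vxy] _] x_free]]]]]].
have [L [j [jE Exy]]] := exp_extension y_neq0 x_free.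
have [tr trP] := choice (@mpoly_expPoly F n).
(* No inequations are imposed: the multiplicative coordinates are values of [Exp], hence nonzero. *)
have [|a [Va _]] := ecF n [seq tr p | p <- V] [::].
  exists L, (j \o iota : {rmorphism F -> L}); split=> //.
  exists (fun i => j (x i)); split=> //; apply/allP => _ /mapP [p pV ->].
  rewrite trP (eval_point_rmorph _ _ (fun=> erefl) Exy).
  by rewrite /eval_point /= Vxy // rmorph0.
exists a; split=> [i|p pV]; first exact: Exp_neq0.
have /eqP := allP Va _ (map_f tr pV).
by rewrite (trP _ _ (idfun : {rmorphism F -> F})).
Qed.
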